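(* For every $1\le\alpha\le\mathcal N$ and every $P\in\mathbb C[x_1^{\pm1},\dots,x_\alpha^{\pm1}]^{S(\alpha)}$, the generalized Macdonald operator $\mathcal A_\alpha(P)$ can be expressed as a (noncommutative) polynomial with complex coefficients in the operators $\mathcal D_{1;n}$, $n\in\mathbb Z$.
   Context: Let $\mathfrak q,\mathfrak t\in\mathbb C^\times$ be such that $\mathfrak q$, $1/\mathfrak t$, $\mathfrak t/\mathfrak q$ are not roots of unity; fix $\theta$ with $\theta^2=\mathfrak t$. Fix $\mathcal N\ge1$. $\mathcal B$ is the $\mathbb C$-algebra generated by $x_i^{\pm1},\Gamma_i^{\pm1}$ ($1\le i\le\mathcal N$), all commuting except $\Gamma_ix_i=\mathfrak q x_i\Gamma_i$, localized at the multiplicative set generated by $x_i-\mathfrak q^mx_j$ ($i\ne j$, $m\in\mathbb Z$). For symmetric Laurent $P$ in $\alpha$ variables, $\mathcal A_\alpha(P)=\frac{1}{\alpha!(\mathcal N-\alpha)!}\mathrm{Sym}_{x_1,\dots,x_{\mathcal N}}\Big(P(x_1,\dots,x_\alpha)\prod_{1\le i\le\alpha<j\le\mathcal N}\frac{\theta x_i-\theta^{-1}x_j}{x_i-x_j}\Gamma_1\cdots\Gamma_\alpha\Big)$, where Sym permutes the indices of $x_i$ and $\Gamma_i$ simultaneously. $\mathcal D_{1;n}$ is the coefficient of $z^n$ in $\mathfrak d(z)=(\mathfrak q^{-1/2}-\mathfrak q^{1/2})\mathfrak e_1(\mathfrak q^{-1/2}z)$, where $\mathfrak e_1(z)=\frac{\mathfrak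 q^{1/2}}{1-\mathfrak q}\sum_{i=1}^{\mathcal N}\delta(\mathfrak q^{1/2}x_iz)\prod_{j\ne i}\frac{\theta x_i-\theta^{-1}x_j}{x_i-x_j}\Gamma_i$ and $\delta(z)=\sum_nz^n$; explicitly $\mathcal D_{1;n}=\sum_{i=1}^{\mathcal N}x_i^n\prod_{j\ne i}\frac{\theta x_i-\theta^{-1}x_j}{x_i-x_j}\Gamma_i=\mathcal A_1(x^n)$. *)

(* Defs.v *)
From HB Require Import structures.
From mathcomp Require Import all_boot all_order all_algebra all_fingroup.
From mathcomp Require Import generic_quotient fraction.
From mathcomp Require Import reals.
From mathcomp.real_closed Require Import complex.
From mathcomp.multinomials Require Import mpoly.

Set Implicit Arguments.
Unset Strict Implicit.
Unset Printing Implicit Defensive.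

Import GRing.Theory Num.Theory.
Local Open Scope ring_scope.

(* The complex numbers are modelled as R[i] = complex R for a realType R.   *)
(* The algebra B (generated by x_i^{+-1}, Gamma_i^{+-1}, localized at the    *)
(* x_i - q^m x_j) is modelled through its (faithful) action on the field    *)
(* K = C(x_1,...,x_N) = {fraction {mpoly C[N]}}: an element                  *)
(*   sum_k f_k(x) Gamma^k  acts as  g |-> sum_k f_k * (tau^k g)              *)
(* where x_i acts by multiplication and Gamma_i by the q-shift               *)
(* tau_i g(x) = g(x_1,..,q x_i,..,x_N).  Elements of B are thus represented *)
(* as maps K -> K; products are composition.                 *)

Definition not_root_of_unity {F : nzRingType} (z : F) : Prop :=
  forall n : nat, (0 < n)%N -> z ^+ n != 1.

Section Macdonald.
Variable (R : realType).
Local Notation C := (R[i]).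
Variable (N : nat) (q theta : C).

Definition ratfun := {fraction {mpoly C[N]}}.

Definition tof (p : {mpoly C[N]}) : ratfun := @FracField.tofrac _ p.

Definition xK (i : 'I_N) : ratfun := tof 'X_i.

Definition cK (c : C) : ratfun := tof c%:MP.

Definition qshift_poly (i : 'I_N) (p : {mpoly C[N]}) : {mpoly C[N]} :=
  p \mPo [tuple (if j == i then q else 1) *: 'X_j | j < N].

(* ... and on rational functions (well defined on the quotient) *)
Definition qshift (i : 'I_N) (f : ratfun) : ratfun :=
  let r := repr f in tof (qshift_poly i \n_r) / tof (qshift_poly i \d_r).

Definition op := ratfun -> ratfun.

Definition Gamma (i : 'I_N) : op := qshift i.

Definition mulop (f : ratfun) : op := fun g => f * g.

Definition tfactor (i j : 'I_N) : ratfun :=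
  (cK theta * xK i - cK theta^-1 * xK j) / (xK i - xK j).

Definition D1 (n : int) : op := fun g =>
  \sum_(i < N) (xK i ^ n * \prod_(j < N | j != i) tfactor i j) * Gamma i g.

(* A symmetric Laurent polynomial P in alpha variables is given as          *)
(* P = p / (x_1 ... x_alpha)^k with p a symmetric polynomial.  Its value at *)
(* (x_{s(1)}, ..., x_{s(alpha)}) for s a permutation of {1..N}:            *)
Definition evalP (alpha : nat) (Halpha : (alpha <= N)%N)
    (p : {mpoly C[alpha]}) (k : nat) (s : 'S_N) : ratfun :=
  tof (p \mPo [tuple 'X_(s (widen_ord Halpha i)) | i < alpha]) /
  (\prod_(i < alpha) xK (s (widen_ord Halpha i))) ^+ k.

Definition Aop (alpha : nat) (Halpha : (alpha <= N)%N)
    (p : {mpoly C[alpha]}) (k : nat) : op := fun g =>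
  cK (((alpha`! * (N - alpha)`!)%:R)^-1) *
  \sum_(s : 'S_N)
    (evalP Halpha p k s *
       \prod_(i < N | (i < alpha)%N) \prod_(j < N | (alpha <= j)%N)
          tfactor (s i) (s j)) *
    foldr (fun i h => Gamma (s i) \o h) id
          [seq i : 'I_N <- enum 'I_N | (i < alpha)%N] g.

(* the unital C-subalgebra of operators generated by a family S, i.e. the  *)
(* values of noncommutative polynomials with complex coefficients in S      *)
Inductive gen_subalg (S : op -> Prop) : op -> Prop :=
| alg_gen u : S u -> gen_subalg S u
| alg_scal c : gen_subalg S (mulop (cK c))
| alg_add u v : gen_subalg S u -> gen_subalg S v -> gen_subalg S (fun g => u g + v g)
| alg_mul u v : gen_subalg S u -> gen_subalg S v -> gen_subalg S (u \o v).

End Macdonald.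

(* Main.v *)
Require Import Defs.
From HB Require Import structures.
From mathcomp Require Import all_boot all_order all_algebra all_fingroup.
From mathcomp Require Import generic_quotient fraction.
From mathcomp Require Import reals.
From mathcomp.real_closed Require Import complex.
From mathcomp.multinomials Require Import mpoly.
From mathcomp Require Import ring.
From Stdlib Require Import FunctionalExtensionality.
Import GRing.Theory Num.Theory.
Local Open Scope ring_scope.
Set Implicit Arguments.
Unset Strict Implicit.
Unset Printing Implicit Defensive.

(* For a symmetric Laurent polynomial f in a variables let B_a(f) = \sum_{|J| = a} f(x_J) T_J Gamma_J,
   where T_J is the product of the factors t(x_i, x_j) with i in J and j outside J; grouping the
   permutations by the image of {1..a} shows that A_a(f) is a multiple of B_a(f).  Induct on a.
   Write f(v, s) = \sum_b v^b f_b(s).  In \sum_b (D_{n+b} B_a(f_b) - q^{-n} B_a(f_b) D_{n+b}) all terms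
   with a square Gamma_i^2 cancel, and what remains is B_{a+1}(f mu_n), where
     mu_n(x_J) = \sum_{i in J} x_i^n (\prod_{k <> i} w(x_i, x_k) - q^{-n} \prod_{k <> i} w(x_k, x_i))
   and w(y, z) = t(y, z) t(z, q y).  A partial fraction expansion shows that, up to a constant factor,
   the mu_n (n >= 1) are the coefficients of F(u/t) F(t u/q) / (F(u) F(u/q)) - 1, where
   F(u) = \prod_{i in J} (1 - x_i u).  As (1 - t^{-j}) (1 - (t/q)^j) is nonzero, this gives
   B_{a+1}(f e_j) for all j >= 1 by induction on j, hence B_{a+1}(f) since e_{a+1} is invertible. *)

(** * Partial fractions for the functions mu_n *)

Section Lagrange.

Variables (K : fieldType) (I : finType) (x : I -> K) (q th : K).

Implicit Types (J : {set I}) (i : I) (c u : K).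

Definition tfac (a b : K) : K := (th * a - th^-1 * b) / (a - b).

Definition omega (a b : K) : K := tfac a b * tfac b (q * a).

(** This is F(c u) as a polynomial in u, with F(u) the product of the 1 - x_i u over J. *)
Definition linprod (J : {set I}) (c : K) : {poly K} :=
  \prod_(i in J) (1 - (c * x i) *: 'X).

Lemma linprod_set1 J i c : i \in J ->
  linprod J c = (1 - (c * x i) *: 'X) * linprod (J :\ i) c.
Proof. by move=> iJ; rewrite /linprod (big_setD1 i). Qed.

Lemma size_linprod J c : (size (linprod J c) <= #|J|.+1)%N.
Proof.
have -> : #|J| = (\sum_(i in J) 1)%N by rewrite sum1_card.
rewrite /linprod; elim/big_rec2: _ => [|i n p _ Hp]; first by rewrite size_poly1.
apply: leq_trans (size_polyMleq _ _) _.
have s2 : (size (1 - (c * x i) *: 'X : {poly K})%R <= 2)%N.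
  apply: leq_trans (size_polyD _ _) _; rewrite size_poly1 geq_max /= size_polyN.
  by apply: leq_trans (size_scale_leq _ _) _; rewrite size_polyX.
by move: (leq_add s2 Hp); case: (_ + _)%N.
Qed.

Lemma horner_linprod J c u : (linprod J c).[u] = \prod_(i in J) (1 - c * x i * u).
Proof. by rewrite /linprod horner_prod; apply: eq_bigr => i _; rewrite !hornerE. Qed.

Lemma linprod_root J c i : i \in J -> c * x i != 0 ->
  (linprod J c).[(c * x i)^-1] = 0.
Proof.
by move=> iJ ci; rewrite horner_linprod (big_setD1 i) //= divff // subrr mul0r.
Qed.

Hypotheses (q_neq0 : q != 0) (th_neq0 : th != 0).

Local Notation t := (th ^+ 2).

(** The contribution of the index i itself to F(u/t) F(t u/q) / F(u/q) at u = 1/x_i; the other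
    indices contribute values of [omega]. *)
Definition cst0 : K := (1 - t^-1) * (1 - t / q) / (1 - q^-1).

Definition mu (J : {set I}) (n : int) : K :=
  \sum_(i in J) x i ^ n * (\prod_(k in J :\ i) omega (x i) (x k)
                         - q ^ (- n) * \prod_(k in J :\ i) omega (x k) (x i)).

Section OnSet.

Variable J : {set I}.
Hypothesis x_neq0 : forall i, i \in J -> x i != 0.
Hypothesis x_inj : forall i j, i \in J -> j \in J -> i != j -> x i != x j.
Hypothesis x_qfree : forall i j, i \in J -> j \in J -> x i != q * x j.

(** The powers of th in the two factors of [omega] cancel, so [omega a b] is the factor of b in
    F(u/t) F(t u/q) / (F(u) F(u/q)) at u = 1/a. *)
Lemma omega_fwd a b : a != 0 -> a != b -> b != q * a ->
  omega a b * (1 - b / a) * (1 - q^-1 * b / a)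
    = (1 - t^-1 * b / a) * (1 - t / q * b / a).
Proof.
move=> a0 ab bqa; rewrite /omega /tfac; field.
by rewrite ?q_neq0 ?a0 ?th_neq0 ?subr_eq0 ?ab ?bqa ?(eq_sym b a) ?ab.
Qed.

(** The same ratio, now at u = q/a: this second family of poles produces [omega] with its arguments
    exchanged. *)
Lemma omega_bwd a b : a != 0 -> a != b -> a != q * b ->
  omega b a * (1 - b * (q / a)) * (1 - q^-1 * b * (q / a))
    = (1 - t^-1 * b * (q / a)) * (1 - t / q * b * (q / a)).
Proof.
move=> a0 ab bqa; rewrite /omega /tfac; field.
by rewrite ?q_neq0 ?a0 ?th_neq0 ?subr_eq0 ?ab ?bqa ?(eq_sym b a) ?ab.
Qed.

(** The simple fractions x_i u / (1 - x_i u) and (x_i/q) u / (1 - x_i u/q), weighted by products of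
    [omega] and multiplied by F(u) F(u/q) to clear the denominators. *)
Definition lagrange_term i : {poly K} :=
  (\prod_(k in J :\ i) omega (x i) (x k)) *:
     ((x i *: 'X) * linprod (J :\ i) 1 * linprod J q^-1)
  - (\prod_(k in J :\ i) omega (x k) (x i)) *:
     ((x i / q) *: 'X * linprod J 1 * linprod (J :\ i) q^-1).

Lemma horner_lagrange_term i u : (lagrange_term i).[u] =
  (\prod_(k in J :\ i) omega (x i) (x k)) *
     (x i * u * (linprod (J :\ i) 1).[u] * (linprod J q^-1).[u])
  - (\prod_(k in J :\ i) omega (x k) (x i)) *
     (x i / q * u * (linprod J 1).[u] * (linprod (J :\ i) q^-1).[u]).
Proof. by rewrite /lagrange_term !hornerE. Qed.

(* Both sides have degree at most [2 #|J|] and agree at [0] and at the points [1 / x i], [q / x i]. *)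
Lemma lagrange :
  linprod J t^-1 * linprod J (t / q) - linprod J 1 * linprod J q^-1
  = cst0 *: \sum_(i in J) lagrange_term i.
Proof.
apply/eqP; rewrite -subr_eq0; set D : {poly K} := _ - _.
pose rs := 0 :: [seq (x i)^-1 | i <- enum J] ++ [seq q / x i | i <- enum J].
(* This is [x_qfree] at (i, i), hence available only when J has an element; it is needed only at the
   points attached to some i in J. *)
have q1 i : i \in J -> q != 1.
  move=> iJ; apply/eqP => q1.
  by have := x_qfree iJ iJ; rewrite q1 mul1r eqxx.
have hD r : D.[r] = (linprod J t^-1).[r] * (linprod J (t / q)).[r]
     - (linprod J 1).[r] * (linprod J q^-1).[r]
     - cst0 * \sum_(i in J) (lagrange_term i).[r].
  by rewrite /D !hornerE horner_sum.
have sD : (size D <= (#|J| + #|J|).+1)%N.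
  have szM (p r : {poly K}) m n : (size p <= m.+1)%N -> (size r <= n.+1)%N ->
      (size (p * r : {poly K})%R <= (m + n).+1)%N.
    move=> hp hr; apply: leq_trans (size_polyMleq _ _) _.
    by move: (leq_add hp hr); rewrite addSn addnS; case: (_ + _)%N.
  have szX (a : K) : (size (a *: 'X : {poly K})%R <= 2)%N.
    by apply: leq_trans (size_scale_leq _ _) _; rewrite size_polyX.
  have szB (p r : {poly K}) m : (size p <= m)%N -> (size r <= m)%N -> (size (p - r : {poly K})%R <= m)%N.
    by move=> hp hr; apply: leq_trans (size_polyD _ _) _; rewrite size_polyN geq_max hp hr.
  apply: (szB); first by apply: (szB); apply: (szM); exact: size_linprod.
  apply: leq_trans (size_scale_leq _ _) _; apply: leq_trans (size_sum _ _ _) _.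
  apply/bigmax_leqP => i iJ; have cJ : (#|J| = 1 + #|J :\ i|)%N by rewrite (cardsD1 i) iJ.
  apply: (szB); apply: leq_trans (size_scale_leq _ _) _.
    rewrite {1}cJ; apply: (szM); last exact: size_linprod.
    by apply: (szM); [exact: (szX) | exact: size_linprod].
  rewrite {2}cJ addnA [(#|J| + 1)%N]addnC; apply: (szM); last exact: size_linprod.
  by apply: (szM); [exact: (szX) | exact: size_linprod].
have urs : uniq rs.
  have invI : {in J &, injective (fun i => (x i)^-1)}.
    move=> i j iJ jJ /invr_inj e; apply/eqP; apply: contraT => /(x_inj iJ jJ).
    by rewrite e eqxx.
  rewrite /rs /= mem_cat negb_or cat_uniq; apply/and4P; split.
  - apply/andP; split; apply/mapP => -[ i ]; rewrite mem_enum => iJ /esym/eqP.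
      by rewrite invr_eq0 (negbTE (x_neq0 iJ)).
    by rewrite mulf_eq0 invr_eq0 (negbTE (x_neq0 iJ)) (negbTE q_neq0).
  - by rewrite map_inj_in_uniq ?enum_uniq // => i j; rewrite !mem_enum; apply: invI.
  - apply/hasPn => r /mapP[ i ]; rewrite mem_enum => iJ ->; apply/mapP => -[j].
    rewrite mem_enum => jJ /eqP; rewrite -[X in _ / _ == X]mul1r eqr_div ?x_neq0 //.
    by rewrite mul1r eq_sym (negbTE (x_qfree iJ jJ)).
  - rewrite map_inj_in_uniq ?enum_uniq // => i j; rewrite !mem_enum => iJ jJ.
    by move/(mulfI q_neq0); apply: invI.
(* A nonzero D would have the 2 #|J| + 1 distinct roots [rs], more than its degree allows. *)
apply: contraT => Dn0.
have /(max_poly_roots Dn0)/(_ urs) : all (root D) rs.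
  apply/allP => r; rewrite /rs inE mem_cat => /orP[/eqP->|/orP[]].
  - apply/rootP; rewrite hD (big1 _ _ (fun i => (lagrange_term i).[0])) ?mulr0 ?subr0; last first.
      by move=> i _; rewrite horner_lagrange_term !(mulr0, mul0r) subrr.
    by rewrite !horner_linprod !big1 ?mulr1 ?subrr // => i _; rewrite mulr0 subr0.
  - case/mapP => i; rewrite mem_enum => iJ ->; have x0 := x_neq0 iJ.
    (* At 1/x_i the terms of all k other than i vanish, since F over J and F over J minus k both
       have this root; of the term of i only the first half survives. *)
    apply/rootP; rewrite hD (bigD1 i) //= (big1 _ (fun k => (k \in J) && (k != i))) ?addr0; last first.
      move=> k /andP[kJ ki]; have iJk : i \in J :\ k by rewrite !inE eq_sym ki.
      rewrite horner_lagrange_term.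
      have := @linprod_root J 1 i iJ; rewrite mul1r => -> //.
      by have := @linprod_root (J :\ k) 1 i iJk; rewrite mul1r => -> //; rewrite !(mul0r, mulr0) subrr.
    rewrite horner_lagrange_term.
    have r1 : (linprod J 1).[(x i)^-1] = 0.
      by have := @linprod_root J 1 i iJ; rewrite mul1r => ->.
    rewrite r1 !(mul0r, mulr0) subr0 divff // mul1r subr0.
    rewrite (linprod_set1 t^-1 iJ) (linprod_set1 (t / q) iJ) (linprod_set1 q^-1 iJ) !hornerM.
    rewrite !horner_linprod !hornerE -!(mulrA _ (x i)) !divff // !mulr1.
    have E : (\prod_(k in J :\ i) (1 - t^-1 * x k / x i)) *
             (\prod_(k in J :\ i) (1 - t / q * x k / x i))
           = (\prod_(k in J :\ i) omega (x i) (x k)) *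
             (\prod_(k in J :\ i) (1 - 1 * x k / x i)) *
             (\prod_(k in J :\ i) (1 - q^-1 * x k / x i)).
      rewrite -!big_split /=; apply: eq_bigr => k.
      rewrite !inE => /andP[ki kJ]; rewrite mul1r omega_fwd ?x_neq0 ?x_qfree //.
      by apply: x_inj => //; rewrite eq_sym.
    apply/eqP; rewrite subr_eq0; apply/eqP.
    have -> : cst0 = (1 - t^-1) * (1 - t / q) / (1 - q^-1) by [].
    move: E => /=; set P1 := \prod_(_ in _) _; set P2 := \prod_(_ in _) _.
    set P3 := \prod_(_ in _) _; set P4 := \prod_(_ in _) _; set P5 := \prod_(_ in _) _ => E.
    transitivity ((1 - t^-1) * (1 - t / q) * (P1 * P2)); first by ring.
    by rewrite E; field; rewrite q_neq0 th_neq0 subr_eq0 (q1 i iJ).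
  - case/mapP => i; rewrite mem_enum => iJ ->; have x0 := x_neq0 iJ.
    have qx0 : q^-1 * x i != 0 by rewrite mulf_neq0 ?invr_eq0.
    have rE : q / x i = (q^-1 * x i)^-1 by rewrite invfM invrK.
    apply/rootP; rewrite hD (bigD1 i) //= (big1 _ (fun k => (k \in J) && (k != i))) ?addr0; last first.
      move=> k /andP[kJ ki]; have iJk : i \in J :\ k by rewrite !inE eq_sym ki.
      rewrite horner_lagrange_term rE.
      by rewrite (linprod_root iJ qx0) (linprod_root iJk qx0) !(mul0r, mulr0) subrr.
    rewrite horner_lagrange_term.
    have r1 : (linprod J q^-1).[q / x i] = 0 by rewrite rE linprod_root.
    rewrite r1 !(mul0r, mulr0) subr0 sub0r.
    have -> : x i / q * (q / x i) = 1 by field; rewrite q_neq0 x0.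
    rewrite mul1r (linprod_set1 t^-1 iJ) (linprod_set1 (t / q) iJ) (linprod_set1 1 iJ) !hornerM.
    rewrite !horner_linprod !hornerE.
    have E : (\prod_(k in J :\ i) (1 - t^-1 * x k * (q / x i))) *
             (\prod_(k in J :\ i) (1 - t / q * x k * (q / x i)))
           = (\prod_(k in J :\ i) omega (x k) (x i)) *
             (\prod_(k in J :\ i) (1 - 1 * x k * (q / x i))) *
             (\prod_(k in J :\ i) (1 - q^-1 * x k * (q / x i))).
      rewrite -!big_split /=; apply: eq_bigr => k.
      rewrite !inE => /andP[ki kJ]; rewrite mul1r omega_bwd ?x_neq0 ?x_qfree //.
      by apply: x_inj => //; rewrite eq_sym.
    apply/eqP; rewrite subr_eq0; apply/eqP.
    have -> : cst0 = (1 - t^-1) * (1 - t / q) / (1 - q^-1) by [].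
    move: E => /=; set P1 := \prod_(_ in _) _; set P2 := \prod_(_ in _) _.
    set P3 := \prod_(_ in _) _; set P4 := \prod_(_ in _) _; set P5 := \prod_(_ in _) _ => E.
    (* The index i contributes (1 - q/t) (1 - t) = q (1 - 1/t) (1 - t/q) here. As - (1 - q) / (1 -
       1/q) = q, the constant found at 1/x_i also fits q/x_i, given the minus sign in
       [lagrange_term]. *)
    transitivity ((1 - q / t) * (1 - t) * (P1 * P2)).
      by field; rewrite q_neq0 th_neq0 x0.
    by rewrite E; field; rewrite q_neq0 th_neq0 subr_eq0 (q1 i iJ) x0.
rewrite /= size_cat !size_map -cardE => H.
by have := leq_trans H sD; rewrite ltnn.
Qed.

(** Here v X r is p times v X / (1 - v X); the geometric series is expanded coefficientwise, without
    formal power series. *)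
Lemma coef_geometric (v : K) (p r : {poly K}) j : p = (1 - v *: 'X) * r ->
  ((v *: 'X) * r)`_j = \sum_(m < j) v ^+ m.+1 * p`_(j - m.+1).
Proof.
move=> pE; have rE : (v *: 'X) * r = v *: ('X * (p + (v *: 'X) * r)).
  by rewrite pE -scalerAl; congr (_ *: (_ * _)); rewrite mulrBl mul1r -scalerAl subrK.
elim: j => [|j IH]; first by rewrite big_ord0 rE coefZ coefXM /= mulr0.
rewrite rE coefZ coefXM /= coefD IH big_ord_recl mulrDr subSS subn0 expr1.
congr (_ + _); rewrite mulr_sumr; apply: eq_bigr => m _.
by rewrite lift0 subSS mulrA -exprS.
Qed.

(** Expanding both simple fractions of [lagrange] as geometric series gives powers of x_i and of
    x_i/q; the latter account for the q^(-n) in [mu]. *)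
Lemma coef_lagrange j :
  (linprod J t^-1 * linprod J (t / q) - linprod J 1 * linprod J q^-1)`_j
  = cst0 * \sum_(m < j) mu J m.+1 * (linprod J 1 * linprod J q^-1)`_(j - m.+1).
Proof.
rewrite lagrange coefZ; congr (_ * _); rewrite coef_sum.
under [RHS]eq_bigr do rewrite /mu mulr_suml.
rewrite exchange_big /=; apply: eq_bigr => i iJ.
rewrite /lagrange_term coefB !coefZ -!mulrA.
rewrite (@coef_geometric (x i) (linprod J 1 * linprod J q^-1)); last first.
  by rewrite (linprod_set1 1 iJ) mul1r !mulrA.
rewrite (@coef_geometric (x i / q) (linprod J 1 * linprod J q^-1)); last first.
  by rewrite mulrCA (linprod_set1 q^-1 iJ) (mulrC (x i)).
rewrite !mulr_sumr -sumrB; apply: eq_bigr => m _.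
by rewrite -exprnN -exprnP exprMn exprVn; ring.
Qed.

End OnSet.

Lemma coef_linprod J c j : (linprod J c)`_j = c ^+ j * (linprod J 1)`_j.
Proof.
rewrite /linprod; elim/big_rec2: _ j => [|i p r _ IH] j.
  by rewrite coef1; case: j => [|j]; rewrite ?mulr1 ?mulr0.
rewrite !mulrBl !coefB !mul1r -!scalerAl !coefZ !coefXM !IH.
case: j => [|j] /=; first by rewrite !mulr0 !subr0.
by rewrite exprS; ring.
Qed.

End Lagrange.

(* Symmetric functions in any number of variables; [SEsf j] stands for the [j]-th coefficient of
   [\prod_v (1 - v X)], i.e. a signed elementary symmetric function. *)
Inductive sexp (C : Type) : Type :=
| SCst of C
| SEsf of nat
| SInv
| SAdd of sexp C & sexp C
| SMul of sexp C & sexp C.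

Arguments SEsf {C} _.
Arguments SInv {C}.

(** * Evaluation of symmetric expressions and separation of one variable *)

Section SymmetricExpressions.

Variables (C K : fieldType) (iota : {rmorphism C -> K}).
Implicit Types (e : sexp C) (s : seq K).

Fixpoint seval e s : K :=
  match e with
  | SCst c => iota c
  | SEsf j => (\prod_(v <- s) (1 - v *: 'X))`_j
  | SInv => (\prod_(v <- s) v)^-1
  | SAdd e1 e2 => seval e1 s + seval e2 s
  | SMul e1 e2 => seval e1 s * seval e2 s
  end.

Lemma seval_perm e s s' : perm_eq s s' -> seval e s = seval e s'.
Proof.
move=> ss'; elim: e => [c|j||e1 IH1 e2 IH2|e1 IH1 e2 IH2] //=.
- by rewrite (perm_big _ ss').
- by rewrite (perm_big _ ss').
- by rewrite IH1 IH2.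
- by rewrite IH1 IH2.
Qed.

Lemma seval_morph (g : {rmorphism K -> K}) e s :
  (forall c, g (iota c) = iota c) -> g (seval e s) = seval e (map g s).
Proof.
move=> gc; elim: e => [c|j||e1 IH1 e2 IH2|e1 IH1 e2 IH2] //=.
- rewrite -coef_map rmorph_prod big_map; congr (polyseq _)`_j; apply: eq_bigr => v _.
  by rewrite rmorphB rmorph1 /= map_polyZ map_polyX.
- by rewrite fmorphV rmorph_prod big_map.
- by rewrite rmorphD IH1 IH2.
- by rewrite rmorphM IH1 IH2.
Qed.

(** The pairs (b, f_b) in f(v, s) = \sum_b v^b f_b(s). An exponent may occur repeatedly; negative
    ones come only from [SInv]. *)
Fixpoint sdecomp e : seq (int * sexp C) :=
  match e with
  | SCst c => [:: (0, SCst c)]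
  | SEsf j => if j is j'.+1 then [:: (0, SEsf j); (1, SMul (SCst (-1)) (SEsf j'))]
              else [:: (0, SEsf 0)]
  | SInv => [:: (-1, SInv)]
  | SAdd e1 e2 => sdecomp e1 ++ sdecomp e2
  | SMul e1 e2 => [seq (p.1 + p'.1, SMul p.2 p'.2) | p <- sdecomp e1, p' <- sdecomp e2]
  end.

Lemma sdecompE e v s : v != 0 ->
  seval e (v :: s) = \sum_(p <- sdecomp e) v ^ p.1 * seval p.2 s.
Proof.
move=> v0; elim: e => [c|j||e1 IH1 e2 IH2|e1 IH1 e2 IH2] /=.
- by rewrite big_seq1 mul1r.
- rewrite big_cons mulrBl mul1r coefB -scalerAl coefZ coefXM.
  case: j => [|j]; first by rewrite big_seq1 /= mulr0 subr0 mul1r.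
  by rewrite big_cons big_seq1 /= expr1z mul1r rmorphN1 mulN1r mulrN.
- by rewrite big_cons big_seq1 /= invfM exprN1.
- by rewrite big_cat /= IH1 IH2.
- rewrite big_allpairs_dep /= IH1 IH2 mulr_suml; apply: eq_bigr => p _.
  rewrite mulr_sumr; apply: eq_bigr => p' _.
  by rewrite expfzDr //; ring.
Qed.

End SymmetricExpressions.

(** * Symmetric Laurent polynomials as symmetric expressions *)

Section SymmetricPolynomials.

Variables (C K : fieldType) (iota : {rmorphism C -> K}) (n : nat).
Implicit Types (y : 'I_n -> K) (F : ('I_n -> K) -> K).

Definition vals y : seq K := [seq y i | i <- enum 'I_n].

(** One expression must serve all y, because the same polynomial is later evaluated at the variables
    permuted by every s. *)
Definition sexp_rep F : Prop := exists e : sexp C, forall y, F y = seval iota e (vals y).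

Lemma rep_cst c : sexp_rep (fun=> iota c).
Proof. by exists (SCst c). Qed.

Lemma rep_mul F F' : sexp_rep F -> sexp_rep F' -> sexp_rep (fun y => F y * F' y).
Proof. by move=> [e eF] [e' eF']; exists (SMul e e') => y; rewrite eF eF'. Qed.

Lemma rep_sum (T : Type) (s : seq T) (F : T -> ('I_n -> K) -> K) :
  (forall r, sexp_rep (F r)) -> sexp_rep (fun y => \sum_(r <- s) F r y).
Proof.
move=> rF; elim: s => [|r s [e eF]].
  by exists (SCst 0) => y; rewrite big_nil /= rmorph0.
by have [e' eF'] := rF r; exists (SAdd e' e) => y; rewrite big_cons eF eF'.
Qed.

Lemma rep_prod (T : Type) (s : seq T) (F : T -> ('I_n -> K) -> K) :
  (forall r, sexp_rep (F r)) -> sexp_rep (fun y => \prod_(r <- s) F r y).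
Proof.
move=> rF; elim: s => [|r s [e eF]].
  by exists (SCst 1) => y; rewrite big_nil /= rmorph1.
by have [e' eF'] := rF r; exists (SMul e' e) => y; rewrite big_cons eF eF'.
Qed.

Lemma rep_exp F k : sexp_rep F -> sexp_rep (fun y => F y ^+ k).
Proof.
move=> rF; elim: k => [|k IH]; first by exists (SCst 1) => y; rewrite /= rmorph1.
have [e eF] := rep_mul rF IH; by exists e => y; rewrite exprS eF.
Qed.

Lemma coef_prod_linear y k :
  (\prod_(i < n) (1 - y i *: 'X))`_k
  = (-1) ^+ k * \sum_(h : {set 'I_n} | #|h| == k) \prod_(i in h) y i.
Proof.
under eq_bigr do rewrite addrC -scaleNr.
rewrite (bigA_distr _ _ (fun i => (- y i) *: 'X) (fun=> 1)) coef_sum mulr_sumr big_mkcond [RHS]big_mkcond /=.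
apply: eq_bigr => h _; rewrite -big_mkcond /= scaler_prod /= prodr_const coefZ coefXn prodrN.
by rewrite eq_sym; case: eqP => [->|_]; rewrite ?mulr1 ?mulr0.
Qed.

Lemma rep_mesym k : sexp_rep (fun y => mmap iota y (mesym n C k)).
Proof.
exists (SMul (SCst ((-1) ^+ k)) (SEsf k)) => y /=.
rewrite /vals big_map big_enum /= coef_prod_linear mulrA rmorphXn rmorphN1 -expr2 sqrr_sign mul1r.
rewrite /mesym rmorph_sum; apply: eq_bigr => h _; rewrite rmorph_prod.
by apply: eq_bigr => i _; rewrite /= mmapX mmap1U.
Qed.

(** By the fundamental theorem p is a polynomial u in the elementary symmetric polynomials, which
    are representable by [rep_mesym]. *)
Lemma rep_symmetric (p : {mpoly C[n]}) : p \is symmetric ->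
  sexp_rep (fun y => mmap iota y p).
Proof.
move=> /sym_fundamental[u [<- _]].
have [e eE] : sexp_rep (fun y => \sum_(m <- msupp u) iota u@_m *
    \prod_(i < n) mmap iota y (tnth [tuple mesym n C i.+1 | i < n] i) ^+ m i).
  apply: rep_sum => m; apply: rep_mul; first exact: rep_cst.
  apply: rep_prod => i; apply: rep_exp; rewrite tnth_mktuple; exact: rep_mesym.
exists e => y; rewrite -eE comp_mpolyE rmorph_sum; apply: eq_bigr => m _ /=.
rewrite mmapZ rmorph_prod; congr (_ * _); apply: eq_bigr => i _.
by rewrite rmorphXn.
Qed.

Lemma rep_symmetric_laurent (p : {mpoly C[n]}) k : p \is symmetric ->
  sexp_rep (fun y => mmap iota y p / (\prod_(i < n) y i) ^+ k).
Proof.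
move=> /rep_symmetric rp.
have rI : sexp_rep (fun y => (\prod_(i < n) y i)^-1).
  by exists SInv => y; rewrite /= /vals big_map big_enum.
have [e eE] := rep_mul rp (rep_exp k rI).
by exists e => y; rewrite -eE exprVn.
Qed.

End SymmetricPolynomials.

(** A ring morphism is determined by its values on constants and variables. This serves both to
    compose rescalings of variables and to read a substitution as an evaluation in the fraction
    field. *)
Lemma morph_comp_mpoly (C : comNzRingType) (K : comNzRingType) (n m : nat)
    (iota : {rmorphism C -> K}) (phi : {rmorphism {mpoly C[m]} -> K})
    (lq : n.-tuple {mpoly C[m]}) (y : 'I_n -> K) (p : {mpoly C[n]}) :
  (forall c, phi c%:MP = iota c) -> (forall i, phi (tnth lq i) = y i) ->
  phi (p \mPo lq) = mmap iota y p.
Proof.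
move=> phic phiX; rewrite comp_mpolyE rmorph_sum /mmap; apply: eq_bigr => u _ /=.
rewrite -mul_mpolyC rmorphM phic; congr (_ * _).
rewrite rmorph_prod /mmap1; apply: eq_bigr => i _.
by rewrite rmorphXn phiX.
Qed.

(** * Sums over permutations grouped by the image of a subset *)

Lemma perm_imset_ex (T : finType) (A B : {set T}) : #|A| = #|B| ->
  exists s : {perm T}, s @: A = B.
Proof.
(* Both lists enumerate T, one starting with A and the other with B; the permutation sends each
   entry of u to the entry of v at the same position. *)
move=> cAB; pose u := enum A ++ enum (~: A); pose v := enum B ++ enum (~: B).
have uu (D : {set T}) : uniq (enum D ++ enum (~: D)).
  rewrite cat_uniq !enum_uniq andbT /=; apply/hasPn => z.
  by rewrite !mem_enum inE.
have mu (D : {set T}) z : z \in enum D ++ enum (~: D).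
  by rewrite mem_cat !mem_enum inE orbN.
have cC : #|~: A| = #|~: B| by rewrite (cardsCs (~: A)) (cardsCs (~: B)) !setCK cAB.
have suv : size u = size v by rewrite !size_cat -!cardE cAB cC.
have iv z : (index z u < size v)%N by rewrite -suv index_mem mu.
have uv : uniq v by exact: uu.
have sinj : injective (fun z => nth z v (index z u)).
  move=> z w /eqP; rewrite (set_nth_default w) // nth_uniq // => /eqP e.
  by rewrite -(nth_index z (mu A z)) -/u e nth_index // mu.
exists (perm sinj); apply/eqP; rewrite eqEcard card_imset ?cAB ?leqnn ?andbT; last exact: perm_inj.
apply/subsetP => _ /imsetP[z zA ->]; rewrite permE.
rewrite index_cat mem_enum zA nth_cat.
have zB : (index z (enum A) < size (enum B))%N by rewrite -cardE -cAB cardE index_mem mem_enum.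
by rewrite zB -mem_enum mem_nth.
Qed.

(* All fibres of [s |-> s @: A] are cosets of the stabiliser of [A]. *)
Lemma sum_perm_imset (T : finType) (V : nmodType) (A : {set T}) (F : {set T} -> V) :
  \sum_(s : {perm T}) F (s @: A)
  = (\sum_(J : {set T} | #|J| == #|A|) F J) *+ #|[set s : {perm T} | s @: A == A]|.
Proof.
rewrite (partition_big (fun s : {perm T} => s @: A) (fun J : {set T} => #|J| == #|A|)) /=; last first.
  by move=> s _; rewrite card_imset //; exact: perm_inj.
rewrite -sumrMnl; apply: eq_bigr => J /eqP/esym cJ.
have [r rJ] := perm_imset_ex cJ.
rewrite (eq_bigr (fun=> F J)) => [|s /eqP -> //].
rewrite sumr_const -cardsE; congr (_ *+ _).
rewrite -[RHS](card_imset _ (mulIg r)); apply: eq_card => s.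
transitivity (s @: A == J); first by rewrite inE.
apply/eqP/imsetP => [sJ|[s']].
  exists (s * r^-1)%g; last by rewrite mulgKV.
  rewrite inE; apply/eqP; have := congr1 (fun D : {set T} => r^-1%g @: D) (etrans sJ (esym rJ)).
  rewrite -!imset_comp => e; rewrite -[RHS]imset_id.
  rewrite (eq_imset (g := r^-1%g \o s)) => [|z]; last by rewrite permM.
  by rewrite e; apply: eq_imset => z; rewrite /= permK.
rewrite inE => /eqP s'A ->; rewrite -rJ -{2}s'A -imset_comp.
by apply: eq_imset => z; rewrite permM.
Qed.

(** * The operators D_n and B_a over a field with commuting shifts *)

Section Operators.

Variables (C K : fieldType) (iota : {rmorphism C -> K}) (N : nat) (q th : C).
Variables (x : 'I_N -> K) (G : 'I_N -> {rmorphism K -> K}).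
Hypotheses (q_neq0 : q != 0) (th_neq0 : th != 0).
Hypothesis x_neq0 : forall i, x i != 0.
Hypothesis x_inj : forall i j, i != j -> x i != x j.
Hypothesis x_qfree : forall i j, x i != iota q * x j.
Hypothesis G_cst : forall i c, G i (iota c) = iota c.
Hypothesis G_var : forall i j, G i (x j) = if j == i then iota q * x j else x j.
Hypothesis G_comm : forall i j g, G i (G j g) = G j (G i g).

Local Notation Q := (iota q).
Local Notation tf := (tfac (iota th)).
Local Notation om := (omega Q (iota th)).
Implicit Types (J : {set 'I_N}) (i : 'I_N).

Fixpoint Gseq (s : seq 'I_N) : {rmorphism K -> K} :=
  if s is i :: s' then GRing.RMorphism.clone _ _ (G i \o Gseq s') _
  else GRing.RMorphism.clone _ _ idfun _.

Definition Gset J : {rmorphism K -> K} := Gseq (enum J).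

Definition wt J : K := \prod_(i in J) \prod_(j in ~: J) tf (x i) (x j).

Definition wt1 i : K := \prod_(j | j != i) tf (x i) (x j).

Definition Dop (n : int) (g : K) : K :=
  \sum_i (x i ^ n * wt1 i) * G i g.

(** The coefficient F is any function of the index set, so that f mu_n is allowed without writing
    mu_n as a symmetric expression. *)
Definition Bop (a : nat) (F : {set 'I_N} -> K) (g : K) : K :=
  \sum_(J : {set 'I_N} | #|J| == a) F J * wt J * Gset J g.

Definition vars J : seq K := [seq x i | i <- enum J].

Lemma Gseq_perm s s' g : perm_eq s s' -> Gseq s g = Gseq s' g.
Proof.
have push i r r' : Gseq (r ++ i :: r') g = Gseq (i :: r ++ r') g.
  by elim: r => //= j r IH; rewrite IH /= G_comm.
elim: s s' => [|i s IH] s' ss'.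
  by move: ss'; rewrite perm_sym => /perm_nilP ->.
have is' : i \in s' by rewrite -(perm_mem ss') mem_head.
case/splitPr: is' ss' => r r'; rewrite -[i :: r']cat1s => h.
rewrite push /= (IH (r ++ r')) // -(perm_cons i) (perm_trans h) //.
by rewrite -[i :: _]cat1s perm_catCA.
Qed.

Lemma enum_setU1 i J : i \notin J -> perm_eq (enum (i |: J)) (i :: enum J).
Proof.
move=> iJ; apply: uniq_perm; rewrite /= ?enum_uniq ?mem_enum ?iJ //.
by move=> j; rewrite inE !mem_enum !inE.
Qed.

Lemma enum_setD1 i J : i \in J -> perm_eq (enum J) (i :: enum (J :\ i)).
Proof.
by move=> iJ; have := @enum_setU1 i (J :\ i); rewrite setD11 setD1K //; apply.
Qed.

Lemma Gset_setU1 i J g : i \notin J -> Gset (i |: J) g = G i (Gset J g).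
Proof. by move=> iJ; rewrite /Gset (Gseq_perm _ (enum_setU1 iJ)). Qed.

Lemma G_Gset i J g : G i (Gset J g) = Gset J (G i g).
Proof. by rewrite /Gset; elim: (enum J) => //= j s IH; rewrite G_comm IH. Qed.

Lemma Gset_cst J c : Gset J (iota c) = iota c.
Proof. by rewrite /Gset; elim: (enum J) => //= j s ->; rewrite G_cst. Qed.

Lemma Gset_var J j : Gset J (x j) = if j \in J then Q * x j else x j.
Proof.
rewrite -mem_enum /Gset; elim: (enum J) (enum_uniq J) => //= i s IH /andP[si us].
rewrite IH // inE; case: eqP => [->|ji] /=.
  by rewrite (negbTE si) G_var eqxx.
by case: ifP => _; rewrite ?rmorphM ?G_cst G_var (introF eqP ji).
Qed.

Lemma morph_tf (g : {rmorphism K -> K}) a b : g (iota th) = iota th ->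
  g (tf a b) = tf (g a) (g b).
Proof. by move=> gth; rewrite /tfac fmorph_div !rmorphB !rmorphM fmorphV gth. Qed.

Lemma tf_scale a b : tf (Q * a) (Q * b) = tf a b.
Proof.
have Q0 : Q != 0 by rewrite fmorph_eq0.
rewrite /tfac [_ * (Q * a)]mulrCA [_ * (Q * b)]mulrCA -!mulrBr invfM.
by rewrite mulrACA divff // mul1r.
Qed.

Lemma G_wt_notin i J : i \notin J ->
  G i (wt J) = (\prod_(k in J) \prod_(j in ~: (i |: J)) tf (x k) (x j)) *
               \prod_(k in J) tf (x k) (Q * x i).
Proof.
move=> iJ; rewrite /wt rmorph_prod -big_split /=; apply: eq_bigr => k kJ.
rewrite rmorph_prod (bigD1 i) ?inE //= mulrC morph_tf ?G_cst // !G_var eqxx.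
have ki : k != i by apply: contraNneq iJ => <-.
rewrite (negbTE ki); congr (_ * _); apply: eq_big => [j|j /andP[_ ji]].
  by rewrite !inE negb_or andbC.
by rewrite morph_tf ?G_cst // !G_var (negbTE ki) (negbTE ji).
Qed.

Lemma wt1_split i J : i \notin J ->
  wt1 i = (\prod_(k in J) tf (x i) (x k)) * \prod_(j in ~: (i |: J)) tf (x i) (x j).
Proof.
move=> iJ; rewrite /wt1 (bigID (mem J)) /=; congr (_ * _); apply: eq_bigl => j.
  by case: (boolP (j \in J)) => jJ; rewrite ?andbF ?andbT //; apply: contraNneq iJ => <-.
by rewrite !inE negb_or.
Qed.

Lemma wt_setU1 i J : i \notin J ->
  wt (i |: J) = (\prod_(j in ~: (i |: J)) tf (x i) (x j)) *
                \prod_(k in J) \prod_(j in ~: (i |: J)) tf (x k) (x j).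
Proof. by move=> iJ; rewrite /wt big_setU1. Qed.

Lemma wt_notin i J : i \notin J ->
  wt J = (\prod_(k in J) \prod_(j in ~: (i |: J)) tf (x k) (x j)) *
         \prod_(k in J) tf (x k) (x i).
Proof.
move=> iJ; rewrite /wt -big_split /=; apply: eq_bigr => k kJ.
rewrite (bigD1 i) ?inE //= mulrC; congr (_ * _); apply: eq_bigl => j.
by rewrite !inE negb_or andbC.
Qed.

Lemma Gset_wt1_notin i J : i \notin J ->
  Gset J (wt1 i) = (\prod_(k in J) tf (x i) (Q * x k)) *
                   \prod_(j in ~: (i |: J)) tf (x i) (x j).
Proof.
move=> iJ; rewrite (wt1_split iJ) rmorphM !rmorph_prod /=; congr (_ * _); apply: eq_bigr => j.
  by move=> jJ; rewrite morph_tf ?Gset_cst // !Gset_var jJ (negbTE iJ).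
rewrite !inE negb_or => /andP[_ jJ].
by rewrite morph_tf ?Gset_cst // !Gset_var (negbTE jJ) (negbTE iJ).
Qed.

(** The factor t(x_i, x_k) of [wt1 i] meets the shifted factor t(x_k, q x_i) of [wt J], and together
    they form [om (x i) (x k)]; all other factors make up the weight of the enlarged set. *)
Lemma wt_left i J : i \notin J ->
  wt1 i * G i (wt J) = wt (i |: J) * \prod_(k in J) om (x i) (x k).
Proof.
move=> iJ; rewrite (wt1_split iJ) (G_wt_notin iJ) (wt_setU1 iJ).
have -> : \prod_(k in J) om (x i) (x k)
        = (\prod_(k in J) tf (x i) (x k)) * \prod_(k in J) tf (x k) (Q * x i).
  by rewrite -big_split.
by ring.
Qed.

(** In the opposite order t(x_k, x_i) is left alone and t(x_i, x_k) gets x_k shifted, which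
    exchanges the arguments of [om]. *)
Lemma wt_right i J : i \notin J ->
  wt J * Gset J (wt1 i) = wt (i |: J) * \prod_(k in J) om (x k) (x i).
Proof.
move=> iJ; rewrite (wt_notin iJ) (Gset_wt1_notin iJ) (wt_setU1 iJ).
have -> : \prod_(k in J) om (x k) (x i)
        = (\prod_(k in J) tf (x k) (x i)) * \prod_(k in J) tf (x i) (Q * x k).
  by rewrite -big_split.
by ring.
Qed.

(** Factors between i and another element of J are unchanged when both variables are scaled
    ([tf_scale]); against j outside J only x_i is scaled, by either shift; [G i] fixes the remaining
    factors of [wt J]. *)
Lemma wt_mid i J : i \in J -> wt J * Gset J (wt1 i) = wt1 i * G i (wt J).
Proof.
move=> iJ; have iJ' : i \notin J :\ i by rewrite setD11.
have := wt1_split iJ'; rewrite setD1K // => w1.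
rewrite w1 /wt !(big_setD1 i iJ) /= !rmorphM !rmorph_prod.
have -> : \prod_(k in J :\ i) Gset J (tf (x i) (x k)) = \prod_(k in J :\ i) tf (x i) (x k).
  apply: eq_bigr => k; rewrite !inE => /andP[ki kJ].
  by rewrite morph_tf ?Gset_cst // !Gset_var iJ kJ tf_scale.
have -> : \prod_(j in ~: J) Gset J (tf (x i) (x j)) = \prod_(j in ~: J) G i (tf (x i) (x j)).
  apply: eq_bigr => j; rewrite !inE => jJ.
  rewrite !morph_tf ?Gset_cst ?G_cst // !Gset_var !G_var iJ (negbTE jJ) eqxx.
  by case: eqP => // ji; rewrite ji iJ in jJ.
have -> : \prod_(k in J :\ i) G i (\prod_(j in ~: J) tf (x k) (x j))
        = \prod_(k in J :\ i) \prod_(j in ~: J) tf (x k) (x j).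
  apply: eq_bigr => k; rewrite !inE => /andP[ki kJ]; rewrite rmorph_prod.
  apply: eq_bigr => j; rewrite !inE => jJ.
  rewrite morph_tf ?G_cst // !G_var (negbTE ki); case: eqP => // ji.
  by rewrite ji iJ in jJ.
by ring.
Qed.

(** * The twisted commutator of D with B_a *)

Definition ev (e : sexp C) J : K := seval iota e (vars J).

Lemma vars_setD1 i J : i \in J -> perm_eq (vars J) (x i :: vars (J :\ i)).
Proof. by move=> iJ; rewrite -[_ :: _]/(map x (i :: _)) perm_map // enum_setD1. Qed.

Lemma vars_setU1 i J : i \notin J -> perm_eq (vars (i |: J)) (x i :: vars J).
Proof. by move=> iJ; rewrite -[_ :: _]/(map x (i :: _)) perm_map // enum_setU1. Qed.

Lemma G_vars_notin i J : i \notin J -> map (G i) (vars J) = vars J.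
Proof.
move=> iJ; rewrite /vars -map_comp; apply/eq_in_map => j; rewrite mem_enum => jJ /=.
by rewrite G_var; case: eqP => // ji; rewrite -ji jJ in iJ.
Qed.

Lemma G_ev_notin i J e : i \notin J -> G i (ev e J) = ev e J.
Proof. by move=> iJ; rewrite /ev seval_morph // G_vars_notin. Qed.

Lemma G_ev_in i J e : i \in J ->
  G i (ev e J) = seval iota e (Q * x i :: vars (J :\ i)).
Proof.
move=> iJ; rewrite /ev (seval_perm _ _ (vars_setD1 iJ)) seval_morph //=.
by rewrite G_var eqxx G_vars_notin // setD11.
Qed.

Lemma ev_decomp_setU1 i J e : i \notin J ->
  ev e (i |: J) = \sum_(p <- sdecomp e) x i ^ p.1 * ev p.2 J.
Proof. by move=> iJ; rewrite /ev (seval_perm _ _ (vars_setU1 iJ)) sdecompE. Qed.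

(** The contributions of a pair (i, J), summed over the decomposition of f, to D_{n+b} B_a(f_b) here
    and to q^(-n) B_a(f_b) D_{n+b} in [termR]. *)
Definition termL (f : sexp C) n i J g : K :=
  \sum_(p <- sdecomp f) (x i ^ (n + p.1) * wt1 i) * G i (ev p.2 J * wt J * Gset J g).

Definition termR (f : sexp C) n i J g : K :=
  \sum_(p <- sdecomp f) Q ^ (- n) *
     (ev p.2 J * wt J * Gset J ((x i ^ (n + p.1) * wt1 i) * G i g)).

Let Q_neq0 : Q != 0. Proof. by rewrite fmorph_eq0. Qed.

(* The [G i ^ 2] contributions cancel because [f] takes the same value on
   [x i :: q * x i :: s] and [q * x i :: x i :: s]. *)
Lemma termLR_in f n i J g : i \in J -> termL f n i J g = termR f n i J g.
Proof.
move=> iJ; have xi0 := x_neq0 i.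
pose s := vars (J :\ i); pose W := x i ^ n * wt1 i * G i (wt J) * Gset J (G i g).
have -> : termL f n i J g = seval iota f (x i :: Q * x i :: s) * W.
  rewrite sdecompE // mulr_suml; apply: eq_bigr => p _.
  by rewrite !rmorphM G_ev_in // G_Gset expfzDr // /W -/s; ring.
have -> : termR f n i J g = seval iota f (Q * x i :: x i :: s) * W.
  rewrite sdecompE ?mulf_neq0 // mulr_suml; apply: eq_bigr => p _.
  rewrite !rmorphM /= rmorphXz ?unitfE // Gset_var iJ.
  rewrite /ev (seval_perm _ _ (vars_setD1 iJ)) -/s.
  rewrite expfzDr ?mulf_neq0 // !expfzMl.
  (* The prefactor q^(-n) cancels the q^n that the shift draws from x_i^n; the remaining q^b x_i^b
     is the power of the variable q x_i in the decomposition of f. *)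
  transitivity ((Q ^ (- n) * Q ^ n) * (Q ^ p.1 * x i ^ p.1) *
     seval iota p.2 (x i :: s) * x i ^ n * (wt J * Gset J (wt1 i)) * Gset J (G i g)).
    by ring.
  by rewrite -expfzDr // addNr expr0z wt_mid // /W; ring.
by rewrite (@seval_perm _ _ _ f _ (Q * x i :: x i :: s)) // (perm_catCA [:: _] [:: _]).
Qed.

(** As [G i] fixes f_b(x_J), the sum over b reassembles f on the enlarged set, and [wt_left] handles
    the weights. *)
Lemma termL_notin f n i J g : i \notin J ->
  termL f n i J g = x i ^ n * (\prod_(k in J) om (x i) (x k)) *
     (ev f (i |: J) * wt (i |: J) * Gset (i |: J) g).
Proof.
move=> iJ; rewrite ev_decomp_setU1 // !mulr_suml mulr_sumr; apply: eq_bigr => p _.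
rewrite !rmorphM G_ev_notin // expfzDr // -Gset_setU1 //.
transitivity (x i ^ n * x i ^ p.1 * ev p.2 J * (wt1 i * G i (wt J)) * Gset (i |: J) g).
  by ring.
by rewrite wt_left //; ring.
Qed.

Lemma termR_notin f n i J g : i \notin J ->
  termR f n i J g = x i ^ n * (Q ^ (- n) * \prod_(k in J) om (x k) (x i)) *
     (ev f (i |: J) * wt (i |: J) * Gset (i |: J) g).
Proof.
move=> iJ; rewrite ev_decomp_setU1 // !mulr_suml mulr_sumr; apply: eq_bigr => p _.
rewrite !rmorphM /= rmorphXz ?unitfE // Gset_var (negbTE iJ) expfzDr // -G_Gset -Gset_setU1 //.
transitivity (Q ^ (- n) * x i ^ n * x i ^ p.1 * ev p.2 J * (wt J * Gset J (wt1 i)) *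
              Gset (i |: J) g).
  by ring.
by rewrite wt_right //; ring.
Qed.

(** The bijection sends (i, J) with i outside J to (i, i |: J), with inverse (i, J) to (i, J :\
    i). *)
Lemma sum_pointed_sets a (F : 'I_N -> {set 'I_N} -> K) :
  \sum_i \sum_(J : {set 'I_N} | (#|J| == a) && (i \notin J)) F i J
  = \sum_(J : {set 'I_N} | #|J| == a.+1) \sum_(i in J) F i (J :\ i).
Proof.
rewrite [RHS](exchange_big_dep xpredT) //=; apply: eq_bigr => i _.
rewrite [RHS](reindex_onto (fun J => i |: J) (fun J => J :\ i)) /=; last first.
  by move=> J /andP[_ iJ]; rewrite setD1K.
apply: eq_big => [J|J /andP[_ iJ]]; last by rewrite setU1K.
rewrite setU11 andbT; case: (boolP (i \in J)) => iJ.
  rewrite andbF; apply/esym/negP => /andP[_ /eqP e].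
  by move: iJ; rewrite -e setD11.
by rewrite cardsU1 iJ setU1K // eqxx !andbT add1n eqSS.
Qed.

(** Pairs with i in J cancel by [termLR_in]. The others are grouped by the union of J and i, and
    their sum over i is the defining sum of [mu]. *)
Lemma twisted_commutator a n f g :
  \sum_(p <- sdecomp f) (Dop (n + p.1) (Bop a (ev p.2) g)
                         - Q ^ (- n) * Bop a (ev p.2) (Dop (n + p.1) g))
  = Bop a.+1 (fun J => ev f J * mu x Q (iota th) J n) g.
Proof.
have EL : \sum_(p <- sdecomp f) Dop (n + p.1) (Bop a (ev p.2) g)
        = \sum_i \sum_(J : {set 'I_N} | #|J| == a) termL f n i J g.
  rewrite /Dop exchange_big /=; apply: eq_bigr => i _.
  rewrite [RHS]exchange_big /=; apply: eq_bigr => p _.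
  by rewrite rmorph_sum mulr_sumr.
have ER : \sum_(p <- sdecomp f) Q ^ (- n) * Bop a (ev p.2) (Dop (n + p.1) g)
        = \sum_i \sum_(J : {set 'I_N} | #|J| == a) termR f n i J g.
  rewrite /Bop; under eq_bigr do rewrite mulr_sumr.
  rewrite exchange_big [RHS]exchange_big /=; apply: eq_bigr => J _.
  rewrite [RHS]exchange_big /=; apply: eq_bigr => p _.
  by rewrite rmorph_sum !mulr_sumr.
rewrite sumrB EL ER -sumrB.
under eq_bigr => i _.
  rewrite -sumrB (bigID (fun J : {set 'I_N} => i \in J)) /= big1 ?add0r; last first.
    by move=> J /andP[_ iJ]; rewrite termLR_in // subrr.
  over.
rewrite (sum_pointed_sets a (fun i J => termL f n i J g - termR f n i J g)).
apply: eq_bigr => J _; rewrite /mu mulr_sumr !mulr_suml; apply: eq_bigr => i iJ.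
rewrite termL_notin ?termR_notin ?setD11 // setD1K //; by ring.
Qed.

(** * Induction on a inside an algebra containing all D_n *)

Variable Alg : (K -> K) -> Prop.
Hypothesis Alg_ext : forall u v, u =1 v -> Alg u -> Alg v.
Hypothesis Alg_D : forall n, Alg (Dop n).
Hypothesis Alg_cst : forall c, Alg (fun g => iota c * g).
Hypothesis Alg_add : forall u v, Alg u -> Alg v -> Alg (fun g => u g + v g).
Hypothesis Alg_comp : forall u v, Alg u -> Alg v -> Alg (u \o v).

Hypothesis t_notunity : forall j, (0 < j)%N -> (th ^+ 2)^-1 ^+ j != 1.
Hypothesis tq_notunity : forall j, (0 < j)%N -> (th ^+ 2 / q) ^+ j != 1.

Let Bgood a F := Alg (Bop a F).

Lemma Alg_scale c u : Alg u -> Alg (fun g => iota c * u g).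
Proof. exact: Alg_comp (Alg_cst c). Qed.

Lemma Alg_sum (T : Type) (s : seq T) (u : T -> K -> K) :
  (forall r, Alg (u r)) -> Alg (fun g => \sum_(i <- s) u i g).
Proof.
move=> Au; elim: s => [|i s IH].
  by apply: Alg_ext (Alg_cst 0) => g; rewrite rmorph0 mul0r big_nil.
by apply: Alg_ext (Alg_add (Au i) IH) => g; rewrite big_cons.
Qed.

Lemma Bop_ext a F F' : (forall J, #|J| = a -> F J = F' J) -> Bop a F =1 Bop a F'.
Proof. by move=> FF g; apply: eq_bigr => J /eqP Ja; rewrite FF. Qed.

Lemma Bgood_ext a F F' : (forall J, #|J| = a -> F J = F' J) -> Bgood a F -> Bgood a F'.
Proof. by move=> FF; apply/Alg_ext/Bop_ext. Qed.

Lemma Bgood_scale a c F : Bgood a F -> Bgood a (fun J => iota c * F J).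
Proof.
move=> gF; apply: Alg_ext (Alg_scale c gF) => g.
by rewrite /Bop mulr_sumr; apply: eq_bigr => J _; rewrite !mulrA.
Qed.

Lemma Bgood_sum a (T : Type) (s : seq T) (F : T -> {set 'I_N} -> K) :
  (forall r, Bgood a (F r)) -> Bgood a (fun J => \sum_(i <- s) F i J).
Proof.
move=> gF; apply: Alg_ext (Alg_sum s gF) => g.
rewrite /Bop exchange_big /=; apply: eq_bigr => J _; by rewrite !mulr_suml.
Qed.

Lemma Bgood_add a F F' : Bgood a F -> Bgood a F' -> Bgood a (fun J => F J + F' J).
Proof.
move=> gF gF'; apply: Alg_ext (Alg_add gF gF') => g.
by rewrite /Bop -big_split /=; apply: eq_bigr => J _; rewrite !mulrDl.
Qed.

Lemma seval_nil (e : sexp C) : exists c, seval iota e [::] = iota c.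
Proof.
elim: e => [c|j||e1 [c1 E1] e2 [c2 E2]|e1 [c1 E1] e2 [c2 E2]] /=.
- by exists c.
- by exists (j == 0)%:R; rewrite big_nil coef1 rmorph_nat.
- by exists 1; rewrite big_nil invr1 rmorph1.
- by exists (c1 + c2); rewrite E1 E2 rmorphD.
- by exists (c1 * c2); rewrite E1 E2 rmorphM.
Qed.

(** Only the empty set contributes, with weight 1 and no shift, so this operator is multiplication
    by a constant. *)
Lemma Bgood0 e : Bgood 0 (ev e).
Proof.
have [c ce] := seval_nil e; apply: Alg_ext (Alg_cst c) => g.
rewrite /Bop (big_pred1 set0) => [|J]; last by rewrite /= cards_eq0.
by rewrite /ev /vars /wt /Gset enum_set0 /= ce big_set0 mulr1.
Qed.

Lemma Bgood_mu a f n : (forall e, Bgood a (ev e)) ->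
  Bgood a.+1 (fun J => ev f J * mu x Q (iota th) J n).
Proof.
move=> IH; apply: Alg_ext (fun g => twisted_commutator a n f g) _.
apply: Alg_sum => p; apply: Alg_add; first exact: Alg_comp (Alg_D _) (IH _).
apply: Alg_ext (Alg_scale (- q ^ (- n)) (Alg_comp (IH p.2) (Alg_D (n + p.1)))) => g.
by rewrite rmorphN rmorphXz ?unitfE // mulNr.
Qed.

Lemma evM e f J : ev (SMul e f) J = ev e J * ev f J.
Proof. by []. Qed.

Lemma ev_esf j J : ev (SEsf j) J = (linprod x J 1)`_j.
Proof.
rewrite /ev /vars /= big_map /linprod big_enum; congr (polyseq _)`_j.
by apply: eq_bigr => i _; rewrite mul1r.
Qed.

Lemma ev_esf0 J : ev (SEsf 0) J = 1.
Proof.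
rewrite ev_esf -horner_coef0 horner_linprod big1 // => i _.
by rewrite mulr0 subr0.
Qed.

(** The top coefficient of \prod_v (1 - v X) is the product of the - v, which [SInv] inverts up to
    sign. *)
Lemma ev_esf_top J : ev (SEsf #|J|) J = iota ((-1) ^+ #|J|) * (ev SInv J)^-1.
Proof.
rewrite /ev /= invrK; have -> : #|J| = size (vars J) by rewrite size_map cardE.
have szs (s : seq K) j : (size s < j)%N -> (\prod_(v <- s) (1 - v *: 'X : {poly K}))`_j = 0.
  elim: s j => [|v s IH] [|j] //= sj; first by rewrite big_nil coef1.
  by rewrite big_cons mulrBl mul1r coefB -scalerAl coefZ coefXM /= !IH ?mulr0 ?subr0 // ltnW.
elim: (vars J) => [|v s IH]; first by rewrite !big_nil coef1 /= expr0 mulr1; apply/esym/rmorph1.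
rewrite !big_cons /= mulrBl mul1r coefB -scalerAl coefZ coefXM /= IH szs //.
by rewrite exprS rmorphM rmorphN1; ring.
Qed.

Local Notation t := (th ^+ 2).

Definition sexp_sum (n : nat) (F : nat -> sexp C) : sexp C :=
  foldr (fun k e => SAdd (F k) e) (SCst 0) (index_iota 0 n).

Lemma ev_sum n F J : ev (sexp_sum n F) J = \sum_(k < n) ev (F k) J.
Proof.
rewrite -(big_mkord xpredT (fun k => ev (F k) J)) /sexp_sum.
elim: (index_iota 0 n) => [|k s IH]; first by rewrite big_nil /ev /= rmorph0.
by rewrite big_cons -IH.
Qed.

Definition denom_coef (l : nat) : sexp C :=
  sexp_sum l.+1 (fun k => SMul (SCst (q^-1 ^+ (l - k))) (SMul (SEsf k) (SEsf (l - k)))).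

Lemma ev_denom_coef l J : ev (denom_coef l) J = (linprod x J 1 * linprod x J Q^-1)`_l.
Proof.
rewrite ev_sum coefM; apply: eq_bigr => k _.
rewrite (coef_linprod _ _ Q^-1) -!ev_esf {1}/ev /= -/(ev _ J) rmorphXn /= fmorphV.
by rewrite mulrCA.
Qed.

(** The coefficient of [SEsf k] times [SEsf (j - k)] at u^j in F(u/t) F(t u/q) - F(u) F(u/q). *)
Definition esf_coef (j k : nat) : C := t^-1 ^+ k * (t / q) ^+ (j - k) - q^-1 ^+ (j - k).

(** In [coef_lagrange] at j + 1 the convolution terms k = 0 and k = j + 1 are the multiples of
    [SEsf j.+1]; they are isolated on the left, and the other terms are products of two coefficients
    of smaller positive index. *)
Lemma esf_recurrence j J :
  iota (- ((1 - t^-1 ^+ j.+1) * (1 - (t / q) ^+ j.+1))) * ev (SEsf j.+1) J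
  = iota (cst0 q th) * (\sum_(m < j.+1) mu x Q (iota th) J m.+1 * ev (denom_coef (j - m)) J)
    - \sum_(k < j) iota (esf_coef j.+1 k.+1) * (ev (SEsf k.+1) J * ev (SEsf (j - k)) J).
Proof.
have t0 : t != 0 by rewrite expf_neq0.
have := @coef_lagrange K _ x Q (iota th) (Q_neq0) _ J _ _ _ j.+1.
rewrite fmorph_eq0 th_neq0 => /(_ isT (fun i _ => x_neq0 i) (fun i j _ _ => @x_inj i j)
  (fun i j _ _ => x_qfree i j)).
have -> : cst0 Q (iota th) = iota (cst0 q th).
  by rewrite /cst0 !(rmorphM, rmorphB, fmorphV, rmorph1, rmorphXn).
under [X in _ = _ * X -> _]eq_bigr do rewrite subSS -ev_denom_coef.
move=> <-.
rewrite coefB !coefM -sumrB.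
under [X in _ = X - _]eq_bigr => k _.
  rewrite (coef_linprod _ _ Q^-1) (coef_linprod _ _ (iota th ^- 2)).
  rewrite (coef_linprod _ _ (iota th ^+ 2 / Q)) -!ev_esf.
  rewrite (_ : _ - _ = iota (esf_coef j.+1 k) * (ev (SEsf k) J * ev (SEsf (j.+1 - k)) J)); last first.
    rewrite /esf_coef !(rmorphB, rmorphM, rmorphXn, fmorphV) /=.
    by ring.
  over.
rewrite big_ord_recl big_ord_recr /= subn0 subnn !ev_esf0 mul1r mulr1.
rewrite [X in _ + (X + _)](_ : _ = \sum_(k < j) iota (esf_coef j.+1 k.+1) *
          (ev (SEsf k.+1) J * ev (SEsf (j - k)) J)); last by [].
rewrite addrCA [X in _ = X - _]addrC addrK.
rewrite /bump /= add1n -mulrDl -rmorphD; congr (iota _ * _).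
rewrite /esf_coef subn0 subnn !expr0 !mulr1 mul1r.
(* With A = t^(-j-1) and B = (t/q)^(j+1) this is AB, so the coefficient A + B - AB - 1 of
   [SEsf j.+1] factors as - (1 - A) (1 - B). *)
have -> : q^-1 ^+ j.+1 = t^-1 ^+ j.+1 * (t / q) ^+ j.+1.
  by rewrite -exprMn mulrA mulVf // mul1r.
by ring.
Qed.

(** Multiply [esf_recurrence] by f and use strong induction on j. As f is arbitrary, it can absorb
    [denom_coef] next to [mu], and one of the two factors in each product of smaller
    coefficients. *)
Lemma Bgood_esf a : (forall e, Bgood a (ev e)) ->
  forall j f, (0 < j)%N -> Bgood a.+1 (fun J => ev f J * ev (SEsf j) J).
Proof.
move=> IHa; elim/ltn_ind => -[//|j] IHj f _.
set d := - ((1 - t^-1 ^+ j.+1) * (1 - (t / q) ^+ j.+1)).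
(* Here the assumption enters that neither 1/t nor t/q is a root of unity. *)
have d0 : d != 0 by rewrite oppr_eq0 mulf_neq0 // subr_eq0 eq_sym ?t_notunity ?tq_notunity.
have gX : Bgood a.+1 (fun J => \sum_(m < j.+1) ev (SMul f (denom_coef (j - m))) J * mu x Q (iota th) J m.+1).
  by apply: Bgood_sum => m; apply: Bgood_mu.
have gY : Bgood a.+1 (fun J => \sum_(k < j) iota (- esf_coef j.+1 k.+1) *
       (ev (SMul f (SEsf (j - k))) J * ev (SEsf k.+1) J)).
  by apply: Bgood_sum => k; apply: Bgood_scale; apply: IHj; rewrite // ltnS ltn_ord.
apply: Bgood_ext (Bgood_scale d^-1 (Bgood_add (Bgood_scale (cst0 q th) gX) gY)) => J _.
have D0 : iota d != 0 by rewrite fmorph_eq0.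
apply: (mulfI D0); rewrite fmorphV mulVKf // [RHS]mulrCA esf_recurrence mulrBr.
congr (_ + _).
  rewrite [RHS]mulrCA; congr (_ * _); rewrite mulr_sumr; apply: eq_bigr => m _.
  by rewrite evM; ring.
rewrite mulr_sumr -sumrN; apply: eq_bigr => k _.
by rewrite rmorphN evM; ring.
Qed.

Theorem Bop_in_Alg a e : Alg (Bop a (ev e)).
Proof.
elim: a e => [|a IH] e; first exact: Bgood0.
(* On sets of a + 1 elements (-1)^(a+1) [SInv] is the inverse of [SEsf a.+1], so the multiplier is
   chosen to leave e. *)
have g := @Bgood_esf a IH a.+1 (SMul (SCst ((-1) ^+ a.+1)) (SMul e SInv)) isT.
apply: Bgood_ext g => J Ja.
rewrite -{2}Ja ev_esf_top Ja !evM.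
have I0 : ev SInv J != 0.
  rewrite /ev /= invr_eq0 big_map prodf_seq_neq0; apply/allP => i _ /=; exact: x_neq0.
rewrite mulrACA -rmorphM -expr2 sqrr_sign rmorph1 mul1r mulfK //.
Qed.

(** * From sums over permutations to sums over subsets *)

Section SymmetrizedOperator.

Variables (a : nat) (Ha : (a <= N)%N).
Let A : {set 'I_N} := [set i : 'I_N | (i < a)%N].

Lemma widen_inj : injective (widen_ord Ha).
Proof. by move=> i j /(congr1 val) /= /val_inj. Qed.

Lemma card_initial_segment : #|A| = a.
Proof.
rewrite -[RHS]card_ord -(card_imset _ widen_inj).
apply: eq_card => i; rewrite inE; apply/idP/imsetP => [ia|[j _ ->]]; last exact: (ltn_ord j).
by exists (Ordinal ia) => //; apply: val_inj.
Qed.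

Lemma enum_perm_imset (s : 'S_N) :
  perm_eq [seq s i | i : 'I_N <- enum 'I_N & (i < a)%N] (enum (s @: A)).
Proof.
apply: uniq_perm; [|exact: enum_uniq|].
  by rewrite (map_inj_uniq (@perm_inj _ s)) filter_uniq // enum_uniq.
move=> j; rewrite mem_enum; apply/mapP/imsetP => -[ i ].
  by rewrite mem_filter => /andP[ia _] ->; exists i; rewrite ?inE.
by rewrite inE => ia ->; exists i; rewrite // mem_filter ia mem_enum.
Qed.

Lemma vars_perm_imset (s : 'S_N) :
  perm_eq [seq x (s (widen_ord Ha m)) | m <- enum 'I_a] (vars (s @: A)).
Proof.
rewrite (map_comp x (fun m => s (widen_ord Ha m))) perm_map //; apply: uniq_perm.
- rewrite map_inj_uniq ?enum_uniq // => i j /perm_inj; exact: widen_inj.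
- exact: enum_uniq.
move=> j; rewrite mem_enum; apply/mapP/imsetP => -[ i ].
  by move=> _ ->; exists (widen_ord Ha i); rewrite ?inE //= ltn_ord.
by rewrite inE => ia ->; exists (Ordinal ia); rewrite ?mem_enum //; congr (s _); apply: val_inj.
Qed.

Lemma wt_perm_imset (s : 'S_N) :
  \prod_(i < N | (i < a)%N) \prod_(j < N | (a <= j)%N) tf (x (s i)) (x (s j)) = wt (s @: A).
Proof.
rewrite /wt big_imset /=; last by move=> i j _ _; exact: perm_inj.
apply: eq_big => [i|i _]; first by rewrite inE.
rewrite [RHS](reindex_inj (@perm_inj _ s)) /=; apply: eq_bigl => j.
by rewrite inE mem_imset ?inE -?leqNgt //; exact: perm_inj.
Qed.

Lemma Gseq_foldr (s : 'S_N) (r : seq 'I_N) g :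
  foldr (fun i h => G (s i) \o h) id r g = Gseq [seq s i | i <- r] g.
Proof. by elim: r => //= i r ->. Qed.

Lemma symmetrized_in_Alg c e :
  Alg (fun g => iota c * \sum_(s : 'S_N)
    (seval iota e [seq x (s (widen_ord Ha m)) | m <- enum 'I_a] *
     \prod_(i < N | (i < a)%N) \prod_(j < N | (a <= j)%N) tf (x (s i)) (x (s j))) *
    foldr (fun i h => G (s i) \o h) id [seq i : 'I_N <- enum 'I_N | (i < a)%N] g).
Proof.
(* Each J of size a is the image of the initial segment under as many permutations as its stabiliser
   has, whence the extra multiple of c. *)
apply: Alg_ext (Alg_scale (c *+ #|[set s : 'S_N | s @: A == A]|) (Bop_in_Alg a e)) => g.
have := sum_perm_imset A (fun J => ev e J * wt J * Gset J g).
rewrite card_initial_segment rmorphMn mulrnAl -mulrnAr => <-.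
congr (_ * _); apply: eq_bigr => s _.
rewrite wt_perm_imset (seval_perm _ _ (vars_perm_imset s)); congr (_ * _).
by rewrite Gseq_foldr (Gseq_perm _ (enum_perm_imset s)).
Qed.

End SymmetrizedOperator.

End Operators.

(** * Extension of injective endomorphisms to the field of fractions *)

Section FractionMap.

Variables (A : idomainType) (phi : {rmorphism A -> A}).
Hypothesis phi_inj : injective phi.
Local Notation tofr := (@FracField.tofrac A).

(** Written through [repr] so that it agrees with [qshift] by conversion. *)
Definition fracmap (f : {fraction A}) : {fraction A} :=
  tofr (phi \n_(repr f)) / tofr (phi \d_(repr f)).

Lemma tofrac_neq0 a : a != 0 -> tofr a != 0.
Proof. by rewrite tofrac_eq0. Qed.

Lemma phi_neq0 a : a != 0 -> phi a != 0.
Proof. by apply: contra_neq => pa0; apply: phi_inj; rewrite pa0 rmorph0. Qed.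

Lemma frac_numden (f : {fraction A}) : f = tofr \n_(repr f) / tofr \d_(repr f).
Proof.
have d0 : \d_(repr f) != 0 by exact: denom_ratioP.
apply: (mulIf (tofrac_neq0 d0)); rewrite mulfVK ?tofrac_neq0 //.
rewrite -[f in LHS]reprK; unlock FracField.tofrac; rewrite -[LHS]FracField.pi_mul.
apply/eqmodP; rewrite /= FracField.equivfE /FracField.mulf.
rewrite !numden_Ratio ?mulf_neq0 ?oner_eq0 // !mulr1 mulrC.
by rewrite reprK.
Qed.

(** Independence of the representative: phi preserves the cross-multiplied equality, and injectivity
    keeps denominators nonzero. *)
Lemma fracmap_div a b : b != 0 -> fracmap (tofr a / tofr b) = tofr (phi a) / tofr (phi b).
Proof.
move=> b0; rewrite /fracmap; set f := tofr a / tofr b.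
have d0 : \d_(repr f) != 0 by exact: denom_ratioP.
have := frac_numden f; rewrite {1}/f => /eqP.
rewrite eqr_div ?tofrac_neq0 // -!tofracM tofrac_eq => /eqP e.
apply/eqP; rewrite eqr_div ?tofrac_neq0 ?phi_neq0 // -!tofracM -!rmorphM.
by rewrite e.
Qed.

Lemma fracmap_tofrac a : fracmap (tofr a) = tofr (phi a).
Proof.
by rewrite -[tofr a]divr1 -tofrac1 fracmap_div ?oner_eq0 // rmorph1 tofrac1 divr1.
Qed.

Lemma fracmap_zmod_morphism : zmod_morphism fracmap.
Proof.
move=> f g; rewrite (frac_numden f) (frac_numden g).
set a := (X in tofr X); set b := \d_(repr f); set c := \n_(repr g); set d := \d_(repr g).
have b0 : b != 0 by exact: denom_ratioP.
have d0 : d != 0 by exact: denom_ratioP.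
rewrite -mulNr -tofracN addf_div ?tofrac_neq0 // -!tofracM -tofracD.
rewrite !fracmap_div ?mulf_neq0 // rmorphD !rmorphM rmorphN.
rewrite tofracD !tofracM tofracN -addf_div ?tofrac_neq0 ?phi_neq0 //.
by rewrite mulNr.
Qed.

Lemma fracmap_monoid_morphism : monoid_morphism fracmap.
Proof.
split; first by rewrite -tofrac1 fracmap_tofrac rmorph1.
move=> f g; rewrite (frac_numden f) (frac_numden g).
set a := (X in tofr X); set b := \d_(repr f); set c := \n_(repr g); set d := \d_(repr g).
have b0 : b != 0 by exact: denom_ratioP.
have d0 : d != 0 by exact: denom_ratioP.
rewrite mulf_div -!tofracM !fracmap_div ?mulf_neq0 // !rmorphM mulf_div //.
Qed.

End FractionMap.

(* The abstract form of the theorem, with the coefficients written exactly as in [D1] and [Aop]. *)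
Lemma symmetrized_generated (C K : fieldType) (iota : {rmorphism C -> K}) (N : nat) (q th : C)
    (x : 'I_N -> K) (G : 'I_N -> K -> K) (Alg : (K -> K) -> Prop) :
  let tf i j := (iota th * x i - iota th^-1 * x j) / (x i - x j) in
  q != 0 -> th != 0 ->
  (forall j, (0 < j)%N -> (th ^+ 2)^-1 ^+ j != 1) ->
  (forall j, (0 < j)%N -> (th ^+ 2 / q) ^+ j != 1) ->
  (forall i, x i != 0) ->
  (forall i j, i != j -> x i != x j) ->
  (forall i j, x i != iota q * x j) ->
  (forall i, zmod_morphism (G i)) ->
  (forall i, monoid_morphism (G i)) ->
  (forall i c, G i (iota c) = iota c) ->
  (forall i j, G i (x j) = if j == i then iota q * x j else x j) ->
  (forall i j g, G i (G j g) = G j (G i g)) ->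
  (forall u v, u =1 v -> Alg u -> Alg v) ->
  (forall n : int, Alg (fun g => \sum_(i < N) (x i ^ n * \prod_(j < N | j != i) tf i j) * G i g)) ->
  (forall c, Alg (fun g => iota c * g)) ->
  (forall u v, Alg u -> Alg v -> Alg (fun g => u g + v g)) ->
  (forall u v, Alg u -> Alg v -> Alg (u \o v)) ->
  forall (a : nat) (Ha : (a <= N)%N) (p : {mpoly C[a]}) (k : nat) (c : C),
  p \is symmetric ->
  Alg (fun g => iota c * \sum_(s : 'S_N)
    (mmap iota (fun i => x (s (widen_ord Ha i))) p /
       (\prod_(i < a) x (s (widen_ord Ha i))) ^+ k *
     \prod_(i < N | (i < a)%N) \prod_(j < N | (a <= j)%N) tf (s i) (s j)) *
    foldr (fun i h => G (s i) \o h) id [seq i : 'I_N <- enum 'I_N | (i < a)%N] g).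
Proof.
move=> tf q0 th0 tnu tqnu x0 xinj xq Gz Gm Gc Gx GC Aext AD Ac Aadd Acomp a Ha p k c psym.
pose H i : {rmorphism K -> K} := HB.pack (G i)
  (GRing.isZmodMorphism.Build _ _ _ (Gz i)) (GRing.isMonoidMorphism.Build _ _ _ (Gm i)).
have tfE i j : tf i j = tfac (iota th) (x i) (x j) by rewrite /tf /tfac fmorphV.
have [e eE] := rep_symmetric_laurent iota k psym.
have AD' n : Alg (Dop iota th x H n).
  apply: Aext (AD n) => g; apply: eq_bigr => i _; congr (_ * _ * _).
  by apply: eq_bigr => j _; rewrite tfE.
have := @symmetrized_in_Alg C K iota N q th x H q0 th0 x0 xinj xq Gc Gx GC Alg Aext AD' Ac Aadd Acomp
  tnu tqnu a Ha c e.
apply: Aext => g; congr (_ * _); apply: eq_bigr => s _; congr (_ * _ * _).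
  by rewrite eE.
by apply: eq_bigr => i _; apply: eq_bigr => j _; rewrite tfE.
Qed.

Lemma fracmap_comm (A : idomainType) (phi psi : {rmorphism A -> A}) :
  injective phi -> injective psi -> (forall a, phi (psi a) = psi (phi a)) ->
  forall f, fracmap phi (fracmap psi f) = fracmap psi (fracmap phi f).
Proof.
move=> phiI psiI comm f.
have d0 : \d_(repr f) != 0 by exact: denom_ratioP.
rewrite {2}/fracmap fracmap_div ?phi_neq0 //.
by rewrite [X in fracmap psi X]/fracmap fracmap_div ?phi_neq0 // !comm.
Qed.

(** * Rescaling one variable of a polynomial *)

Section ScaleVariable.

Variables (F : fieldType) (N : nat) (q : F).
Hypothesis q_neq0 : q != 0.

(** The scalar c is a parameter because the inverse of the shift by q is the shift by 1/q. *)
Definition scale_tuple (c : F) (i : 'I_N) : N.-tuple {mpoly F[N]} :=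
  [tuple (if j == i then c else 1) *: 'X_j | j < N].

Definition scale_var (c : F) (i : 'I_N) : {rmorphism {mpoly F[N]} -> {mpoly F[N]}} :=
  GRing.RMorphism.clone _ _ (comp_mpoly (scale_tuple c i)) _.

Lemma scale_varX c i j : scale_var c i 'X_j = (if j == i then c else 1) *: 'X_j.
Proof. by rewrite /= comp_mpolyXU -tnth_nth tnth_mktuple. Qed.

Lemma scale_varC c i d : scale_var c i d%:MP = d%:MP.
Proof. exact: comp_mpolyC. Qed.

Lemma scale_var_comp c d i j p :
  scale_var c i (scale_var d j p)
  = mmap (@mpolyC N F) (fun k => (if k == j then d else 1) *: ((if k == i then c else 1) *: 'X_k)) p.
Proof.
apply: morph_comp_mpoly => [e|k]; first exact: scale_varC.
by rewrite tnth_mktuple -mul_mpolyC rmorphM scale_varC scale_varX mul_mpolyC.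
Qed.

Lemma scale_varK i : cancel (scale_var q i) (scale_var q^-1 i).
Proof.
move=> p; rewrite scale_var_comp -[RHS]comp_mpoly_id /comp_mpoly; apply: eq_bigr => m _.
congr (_ * _); apply: mmap1_eq => k; rewrite tnth_mktuple scalerA.
by case: eqP => _; rewrite ?divff // ?mulr1 scale1r.
Qed.

Lemma scale_var_inj i : injective (scale_var q i).
Proof. exact: can_inj (scale_varK i). Qed.

Lemma scale_var_comm i j p : scale_var q i (scale_var q j p) = scale_var q j (scale_var q i p).
Proof.
rewrite !scale_var_comp; apply: eq_bigr => m _; congr (_ * _); apply: mmap1_eq => k.
by rewrite !scalerA mulrC.
Qed.

Lemma mpolyXU_neq0 i : 'X_i != 0 :> {mpoly F[N]}.
Proof. by apply/eqP => /(congr1 (mcoeff U_(i))); rewrite mcoeffX eqxx mcoeff0 => /eqP; rewrite oner_eq0. Qed.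

(** Compare the coefficients of X_i. The case c = q separates x_i from q x_j for all i and j, the
    case c = 1 separates distinct variables. *)
Lemma mpolyXU_scale_neq c i j : c != 1 \/ i != j -> 'X_i != c%:MP * 'X_j :> {mpoly F[N]}.
Proof.
move=> cij; apply/eqP => /(congr1 (mcoeff U_(i))); rewrite mcoeffCM !mcoeffX eqxx.
have -> : (U_(j) == U_(i))%MM = (j == i).
  by apply/eqP/eqP => [/mnmP/(_ j)|-> //]; rewrite !mnmE eqxx; case: eqP.
case: (eqVneq j i) cij => [_|_] cij /= /eqP; last by rewrite mulr0 oner_eq0.
by rewrite mulr1 eq_sym; case: cij => [/negbTE ->|].
Qed.

End ScaleVariable.

(** * Specialization to rational functions *)

Lemma macdonald_generated (F : fieldType) (N : nat) (q th : F)
    (Alg : ({fraction {mpoly F[N]}} -> {fraction {mpoly F[N]}}) -> Prop) :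
  let tofr := @FracField.tofrac {mpoly F[N]} in
  let x i := tofr 'X_i in
  let cst c := tofr c%:MP in
  let G i := fracmap (scale_var q i) in
  let tf i j := (cst th * x i - cst th^-1 * x j) / (x i - x j) in
  q != 0 -> q != 1 -> th != 0 ->
  (forall j, (0 < j)%N -> (th ^+ 2)^-1 ^+ j != 1) ->
  (forall j, (0 < j)%N -> (th ^+ 2 / q) ^+ j != 1) ->
  (forall u v, u =1 v -> Alg u -> Alg v) ->
  (forall n : int, Alg (fun g => \sum_(i < N) (x i ^ n * \prod_(j < N | j != i) tf i j) * G i g)) ->
  (forall c, Alg (fun g => cst c * g)) ->
  (forall u v, Alg u -> Alg v -> Alg (fun g => u g + v g)) ->
  (forall u v, Alg u -> Alg v -> Alg (u \o v)) ->
  forall (a : nat) (Ha : (a <= N)%N) (p : {mpoly F[a]}) (k : nat) (c : F),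
  p \is symmetric ->
  Alg (fun g => cst c * \sum_(s : 'S_N)
    (tofr (p \mPo [tuple 'X_(s (widen_ord Ha i)) | i < a]) /
       (\prod_(i < a) x (s (widen_ord Ha i))) ^+ k *
     \prod_(i < N | (i < a)%N) \prod_(j < N | (a <= j)%N) tf (s i) (s j)) *
    foldr (fun i h => G (s i) \o h) id [seq i : 'I_N <- enum 'I_N | (i < a)%N] g).
Proof.
move=> tofr x cst G tf q0 q1 th0 tnu tqnu Aext AD Ac Aadd Acomp a Ha p k c psym.
pose iota : {rmorphism F -> {fraction {mpoly F[N]}}} :=
  GRing.RMorphism.clone _ _ (tofr \o @mpolyC N F) _.
have sI := fun i => @scale_var_inj F N q q0 i.
have xq c' i j : c' != 1 \/ i != j -> x i != cst c' * x j.
  by move=> h; rewrite /x /cst -tofracM tofrac_eq mpolyXU_scale_neq.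
have x0 i : x i != 0 by rewrite tofrac_eq0 mpolyXU_neq0.
have xinj i j : i != j -> x i != x j.
  by move=> ij; have := xq 1 i j (or_intror ij); rewrite /cst /tofr mpolyC1 tofrac1 mul1r.
have Gx i j : G i (x j) = if j == i then iota q * x j else x j.
  rewrite /G fracmap_tofrac // scale_varX; case: eqP => _; last by rewrite scale1r.
  by rewrite -mul_mpolyC tofracM.
have Gc i d : G i (iota d) = iota d by rewrite /G fracmap_tofrac // scale_varC.
have := @symmetrized_generated F _ iota N q th x G Alg q0 th0 tnu tqnu x0 xinj
  (fun i j => xq q i j (or_introl q1)) (fun i => fracmap_zmod_morphism (sI i))
  (fun i => fracmap_monoid_morphism (sI i)) Gc Gx
  (fun i j => fracmap_comm (sI i) (sI j) (@scale_var_comm F N q i j))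
  Aext AD Ac Aadd Acomp a Ha p k c psym.
apply: Aext => g; congr (_ * _); apply: eq_bigr => s _; congr (_ / _ * _ * _).
(* Substituting permuted variables and then embedding into fractions is evaluation at the permuted
   x_i. *)
apply/esym/morph_comp_mpoly => [d|i]; first by [].
by rewrite tnth_mktuple.
Qed.

Theorem theorem7p10 (R : realType) (N : nat) (q theta : R[i]) :
  (1 <= N)%N -> q != 0 -> theta != 0 ->
  not_root_of_unity q ->
  not_root_of_unity (theta ^+ 2)^-1 ->
  not_root_of_unity (theta ^+ 2 / q) ->
  forall (alpha : nat), (1 <= alpha)%N ->
  forall (Halpha : (alpha <= N)%N) (p : {mpoly R[i][alpha]}) (k : nat),
    p \is symmetric ->
    gen_subalg (fun u => exists n : int, u = D1 q theta n) (Aop q theta Halpha p k).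
Proof.
move=> _ q0 th0 qnu tnu tqnu a _ Ha p k psym.
have q1 : q != 1 by exact: (qnu 1%N isT).
pose S (u : op R N) := exists n : int, u = D1 q theta n.
have Aext u v : u =1 v -> gen_subalg S u -> gen_subalg S v.
  (* [gen_subalg] is a predicate on functions up to Leibniz equality, so pointwise equal operators
     must be identified. *)
  by move=> /functional_extensionality ->.
exact: (@macdonald_generated R[i] N q theta (gen_subalg S) q0 q1 th0 tnu tqnu Aext
  (fun n => alg_gen (ex_intro _ n (erefl (D1 q theta n)))) (@alg_scal R N S)
  (@alg_add R N S) (@alg_mul R N S) a Ha p k _ psym).
Qed.
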